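(* Let $G$ be the final graph of the uncoordinated construction (described in the context) on a set $P\subset\mathbb{R}^d$ of $n$ points with parameter $s>1$, and let $\alpha$ be the aspect ratio of $P$. Then every vertex of $G$ has degree $O(\lg\alpha\cdot s^d)$, and the average degree of $G$ is $O(s^d)$, where the implied constants depend only on $d$.
   Context: Fix $d\ge 1$; $|xy|$ is Euclidean distance; $\lg$ is logarithm base 2. The aspect ratio is $\alpha=\max_{u,v\in P}|uv|/\min_{u\ne v\in P}|uv|$. Uncoordinated construction: start with the graph $G$ on vertex set $P$ with no edges. Every ordered pair $(p,q)$ of distinct points of $P$ is processed exactly once, in an arbitrary order, one at a time. When $(p,q)$ is processed, the edge $pq$ is added to $G$ unless $G$ currently contains an edge whose endpoints can be labeled $p',q'$ with $|pp'|\le |p'q'|/(2s+2)$ and $|qq'|\le |p'q'|/(2s+2)$. $G$ is the graph after all pairs are processed.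
   Formalization: The degree bound is stated as O((1 + lg α)·s^d), since for two points α = 1 and lg α = 0 while each degree is 1; the set P is assumed to have n ≥ 2 points so that α is defined. *)

(* Defs.v *)
From HB Require Import structures.
From mathcomp Require Import all_boot all_order all_algebra.
From mathcomp Require Import reals exp.
Set Implicit Arguments. Unset Strict Implicit. Unset Printing Implicit Defensive.
Import Order.TTheory GRing.Theory Num.Theory.
Local Open Scope ring_scope.

Section Uncoordinated.
Variables (R : realType) (d : nat).

Definition pt := 'rV[R]_d.

Definition dist (x y : pt) : R := Num.sqrt (\sum_(i < d) (x 0 i - y 0 i) ^+ 2).

Definition lg (x : R) : R := ln x / ln 2.

Definition diam (P : seq pt) : R :=
  \big[Num.max/0]_(u <- P) \big[Num.max/0]_(v <- P) dist u v.
Definition mindist (P : seq pt) : R :=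
  \big[Num.min/diam P]_(u <- P) \big[Num.min/diam P]_(v <- P | u != v) dist u v.
Definition aspect_ratio (P : seq pt) : R := diam P / mindist P.

Definition ordered_pairs (P : seq pt) : seq (pt * pt) :=
  [seq x <- [seq (p, q) | p <- P, q <- P] | x.1 != x.2].

Definition blocks (s : R) (e : pt * pt) (pq : pt * pt) : bool :=
  let c := 2 * s + 2 in
  let ok a b := (dist pq.1 a <= dist a b / c) && (dist pq.2 b <= dist a b / c) in
  ok e.1 e.2 || ok e.2 e.1.

Definition step (s : R) (E : seq (pt * pt)) (pq : pt * pt) : seq (pt * pt) :=
  if has (fun e => blocks s e pq) E then E else pq :: E.

(* final graph (edge list, each edge an unordered pair stored as an ordered one) *)
Definition uncoordinated (s : R) (ord : seq (pt * pt)) : seq (pt * pt) :=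
  foldl (step s) [::] ord.

Definition adj (E : seq (pt * pt)) (u v : pt) : bool :=
  ((u, v) \in E) || ((v, u) \in E).

Definition degree (P : seq pt) (E : seq (pt * pt)) (v : pt) : nat :=
  count (fun u => adj E u v) P.

Definition avg_degree (P : seq pt) (E : seq (pt * pt)) : R :=
  (\sum_(v <- P) (degree P E v)%:R) / (size P)%:R.

End Uncoordinated.

(* Main.v *)
Require Import Defs.
From HB Require Import structures.
From mathcomp Require Import all_boot all_order all_algebra.
From mathcomp Require Import boolp reals exp.
From mathcomp Require Import ring lra.
Set Implicit Arguments. Unset Strict Implicit. Unset Printing Implicit Defensive.
Import Order.TTheory GRing.Theory Num.Theory.
Local Open Scope ring_scope.

(* Write c = 2s + 2.  Of two edges of the final graph, the later one is not
   blocked by the earlier one.  Hence two neighbours of v whose distances to v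
   lie in [L, 2L) are more than L / c apart, and a packing argument leaves
   O(s^d) neighbours in each of the 1 + lg alpha dyadic length classes.

   For the average degree, order P farthest first as x_0, x_1, ... and let r_j
   be the distance from x_j to its predecessors: the first j points are pairwise
   at least r_j apart, and every point is within r_j of one of them.  Moving
   both endpoints of an edge of length l by at most l / (4c) onto the coarsest
   prefix that allows it is injective, because two edges with the same image
   would block each other.  The image (x_i, x_j), i < j, satisfies
   |x_i x_j| <= (4c + 2) r_j, so by packing each j receives O(s^d) edges. *)

(** * Euclidean distance and packing *)

(** Expanding the nonnegative sum of [(B * a i - C * b i) ^+ 2] gives [B * (A * B - C ^+ 2)];
    dividing by [B] leaves the degenerate case [B = 0] apart. *)
Lemma cauchy_schwarz_sum (R : realFieldType) (I : finType) (a b : I -> R) :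
  (\sum_i a i * b i) ^+ 2 <= (\sum_i a i ^+ 2) * (\sum_i b i ^+ 2).
Proof.
set A := \sum_i a i ^+ 2; set B := \sum_i b i ^+ 2; set C := \sum_i _.
have B0 : 0 <= B by apply: sumr_ge0 => i _; exact: sqr_ge0.
have [B_eq0|B_neq0] := eqVneq B 0.
  have b0 i : b i = 0.
    apply/eqP; rewrite -sqrf_eq0.
    by move/psumr_eq0P: B_eq0 => -> // j _; exact: sqr_ge0.
  have -> : C = 0 by rewrite /C big1 // => i _; rewrite b0 mulr0.
  by rewrite B_eq0 mulr0 expr0n.
have : 0 <= \sum_i (B * a i - C * b i) ^+ 2.
  by apply: sumr_ge0 => i _; exact: sqr_ge0.
have -> : \sum_i (B * a i - C * b i) ^+ 2 = B * (A * B - C ^+ 2).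
  under eq_bigr => i _ do have -> : (B * a i - C * b i) ^+ 2 =
    B ^+ 2 * a i ^+ 2 - (2 * B * C) * (a i * b i) + C ^+ 2 * b i ^+ 2 by ring.
  rewrite big_split sumrB /= -!mulr_sumr -/A -/B -/C; ring.
by rewrite pmulr_rge0 ?lt_def ?B_neq0 // subr_ge0.
Qed.

Section Dist.
Variables (R : realType) (d : nat).
Implicit Types x y z : pt R d.

Lemma sumsq_ge0 x y : 0 <= \sum_(i < d) (x 0 i - y 0 i) ^+ 2.
Proof. by apply: sumr_ge0 => i _; exact: sqr_ge0. Qed.

Lemma dist_ge0 x y : 0 <= dist x y.
Proof. exact: sqrtr_ge0. Qed.

Lemma dist_xx x : dist x x = 0.
Proof. by rewrite /dist big1 ?sqrtr0 // => i _; rewrite subrr expr0n. Qed.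

Lemma dist_sym x y : dist x y = dist y x.
Proof. by rewrite /dist; under eq_bigr => i _ do rewrite -sqrrN opprB. Qed.

Lemma coord_le_dist x y i : `|x 0 i - y 0 i| <= dist x y.
Proof.
rewrite -sqrtr_sqr ler_sqrt ?sumsq_ge0 // (bigD1 i) //= lerDl.
by apply: sumr_ge0 => j _; exact: sqr_ge0.
Qed.

Lemma dist_gt0 x y : x != y -> 0 < dist x y.
Proof.
move=> xy; rewrite lt_def dist_ge0 andbT; apply: contra_neq xy => xy0.
apply/rowP => i; apply/eqP; rewrite -subr_eq0 -normr_le0 -xy0.
exact: coord_le_dist.
Qed.

Lemma dist_triangle y x z : dist x z <= dist x y + dist y z.
Proof.
set a := fun i => x 0 i - y 0 i; set b := fun i => y 0 i - z 0 i.
have CS := cauchy_schwarz_sum a b.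
rewrite -[leRHS]ger0_norm ?addr_ge0 ?dist_ge0 // -sqrtr_sqr ler_sqrt ?sqr_ge0 //.
have -> : \sum_(i < d) (x 0 i - z 0 i) ^+ 2 =
  dist x y ^+ 2 + 2 * (\sum_i a i * b i) + dist y z ^+ 2.
  rewrite !sqr_sqrtr ?sumsq_ge0 // mulr_sumr -!big_split /=.
  by apply: eq_bigr => i _; rewrite /a /b; ring.
have : \sum_i a i * b i <= dist x y * dist y z.
  apply: (le_trans (ler_norm _)).
  by rewrite -sqrtr_sqr -sqrtrM ?sumsq_ge0 // ler_sqrt // mulr_ge0 ?sumsq_ge0.
by move=> h; rewrite sqrrD -mulr_natl; nra.
Qed.

(** Using [d.+1] in place of the square root of [d] gives a strict inequality, as [d < d.+1 ^ 2],
    and a natural number of cells per unit. *)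
Lemma dist_lt_of_coord x y r : 0 < r ->
  (forall i, `|x 0 i - y 0 i| * d.+1%:R <= r) -> dist x y < r.
Proof.
move=> r0 h; rewrite -[ltRHS]ger0_norm ?ltW // -sqrtr_sqr ltr_sqrt ?exprn_gt0 //.
have D0 : 0 < d.+1%:R :> R by rewrite ltr0n.
apply: (@le_lt_trans _ _ (\sum_(i < d) (r / d.+1%:R) ^+ 2)).
  apply: ler_sum => i _; rewrite -[leLHS]real_normK ?num_real //.
  by rewrite lerXn2r ?nnegrE ?divr_ge0 ?(ltW r0) // ler_pdivlMr.
rewrite sumr_const card_ord -[_ *+ d]mulr_natl expr_div_n mulrA.
rewrite ltr_pdivrMr ?exprn_gt0 // mulrC ltr_pM2l ?exprn_gt0 //.
by rewrite -natrX ltr_nat (leq_trans (ltnSn d)) // expnS expn1 leq_pmulr.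
Qed.

(* Points in a common cell of the grid of side r / (d + 1) are less than r
   apart. *)
Lemma packing (v : pt R d) (r K : R) (S : seq (pt R d)) :
  0 < r -> 0 <= K -> uniq S ->
  {in S, forall x, dist x v <= K * r} ->
  {in S &, forall x y, x != y -> r <= dist x y} ->
  (size S)%:R <= (2 * K * d.+1%:R + 1) ^+ d.
Proof.
move=> r0 K0 uS nearS sepS.
(* [h x i] is a coordinate in units of the cell side [r / d.+1], shifted to lie in
   [[0, 2 * K * d.+1]]; its truncation is the cell index. *)
pose h (x : pt R d) i : R := d.+1%:R * ((x 0 i - v 0 i) / r + K).
pose M := Num.trunc (2 * K * d.+1%:R).
have D0 : 0 < d.+1%:R :> R by rewrite ltr0n.
have hb x i : x \in S -> 0 <= h x i <= 2 * K * d.+1%:R.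
  move=> xS; have := le_trans (coord_le_dist x v i) (nearS x xS).
  rewrite ler_norml -mulNr => /andP[].
  rewrite -(ler_pdivlMr _ _ r0) -(ler_pdivrMr _ _ r0) => h1 h2.
  by rewrite /h; apply/andP; split; nra.
pose g x : {ffun 'I_d -> 'I_M.+1} := [ffun i => inord (Num.trunc (h x i))].
have gE x i : x \in S -> (g x i : nat) = Num.trunc (h x i).
  move=> xS; rewrite ffunE inordK // ltnS.
  by apply: le_truncn; case/andP: (hb x i xS).
have ginj : {in S &, injective g}.
  move=> x y xS yS gxy; apply/eqP/negPn/negP => /sepS-/(_ xS yS).
  apply/negP; rewrite -ltNge; apply: dist_lt_of_coord => // i.
  have : Num.trunc (h x i) = Num.trunc (h y i) by rewrite -!gE // gxy.
  case/andP: (hb x i xS) => /truncn_itv/andP[x1 x2] _.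
  case/andP: (hb y i yS) => /truncn_itv/andP[y1 y2] _ E.
  have : `|h x i - h y i| <= 1.
    by move: x1 x2 y1 y2; rewrite E -natr1 ler_norml => *; apply/andP; split; lra.
  have -> : h x i - h y i = (x 0 i - y 0 i) * d.+1%:R / r by rewrite /h; field; lra.
  by rewrite normrM normfV (gtr0_norm r0) ler_pdivrMr // mul1r normrM (gtr0_norm D0).
have : (size S <= M.+1 ^ d)%N.
  rewrite -(size_map g) -[X in (_ <= _ ^ X)%N]card_ord -[X in (_ <= X ^ _)%N]card_ord.
  rewrite -card_ffun -(card_uniqP _) ?max_card //.
  by rewrite map_inj_in_uniq.
rewrite -(ler_nat R) => /le_trans; apply.
rewrite natrX lerXn2r ?nnegrE ?ler0n //.
  by rewrite addr_ge0 ?mulr_ge0 // ltW.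
by rewrite -natr1 lerD2r truncn_le !mulr_ge0 // ltW.
Qed.
End Dist.

(** * Counting and sequences *)

(** Serves both bounds: the fibers are the length classes at a vertex, then the edges charged to one
    index. *)
Lemma size_le_fibers (R : numDomainType) (T : Type) (S : seq T)
    (f : T -> nat) (M : nat) (B : R) :
  all (fun x => (f x < M)%N) S ->
  (forall k, (k < M)%N -> (count (fun x => f x == k) S)%:R <= B) ->
  (size S)%:R <= M%:R * B.
Proof.
move=> fM fB; suff -> : size S = (\sum_(k < M) count (fun x => f x == k) S)%N.
  rewrite natr_sum mulr_natl -[X in _ *+ X]card_ord -sumr_const.
  by apply: ler_sum => k _; exact: fB.
elim: S fM {fB} => [_|x S IH /= /andP[xM SM]]; first by rewrite big1.
rewrite big_split /= -(IH SM) (bigD1 (Ordinal xM)) //= eqxx big1 // => k.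
by rewrite -val_eqE /= eq_sym => /negbTE ->.
Qed.

Lemma seq_argmax (T : eqType) disp (O : orderType disp) (f : T -> O) (S : seq T) :
  S != [::] -> exists2 x, x \in S & {in S, forall y, (f y <= f x)%O}.
Proof.
elim: S => // x [|y S] IH _.
  by exists x; rewrite ?mem_head // => y; rewrite inE => /eqP ->.
have [//|z zS zmax] := IH; case: (leP (f x) (f z)) => xz.
  by exists z; [rewrite in_cons zS orbT|move=> t /predU1P[-> //|/zmax]].
exists x; first exact: mem_head.
by move=> t /predU1P[-> //|/zmax tz]; exact: le_trans tz (ltW xz).
Qed.

Lemma pairwise_mem (T : eqType) (r : rel T) (S : seq T) : pairwise r S ->
  {in S &, forall x y, x != y -> r x y \/ r y x}.
Proof.
elim: S => // x S IH /= /andP[/allP xS /IH {}IH] y z.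
rewrite !in_cons => /predU1P[->|yS] /predU1P[->|zS]; first by rewrite eqxx.
- by left; exact: xS.
- by right; exact: xS.
- exact: IH.
Qed.

(** * Farthest-first orderings *)

Section FarthestFirst.
Variables (R : realDomainType) (T : eqType) (D : T -> T -> R).
Hypotheses (D_ge0 : forall x y, 0 <= D x y) (D_xx : forall x, D x x = 0).

(** With [m q] a point of [A] nearest to [q], take [p] outside [A] maximizing [D p (m p)]. This one
    value [r] is both the covering radius of [A] and the separation of [p] from [A]. *)
Lemma farthest_point (P A : seq T) :
  uniq P -> A != [::] -> (size A < size P)%N ->
  exists p r, [/\ p \in P, p \notin A,
    {in P, forall q, exists2 a, a \in A & D q a <= r} &
    {in A, forall a, r <= D p a}].
Proof.
move=> uP A0 szA.
have /choice[m mP] q : exists a, a \in A /\ {in A, forall b, D q a <= D q b}.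
  have [a aA amin] := seq_argmax (fun a => - D q a) A0.
  by exists a; split=> // b /amin; rewrite lerN2.
have [|p] := seq_argmax (fun q => D q (m q)) (S := [seq q <- P | q \notin A]).
  apply: contraTneq szA => PA; rewrite -leqNgt; apply: uniq_leq_size => // q qP.
  apply: contraT => qA; suff : q \in [::] by [].
  by rewrite -PA mem_filter qA.
rewrite mem_filter => /andP[pA pP] pmax.
exists p, (D p (m p)); split=> // [q qP|a]; last by case: (mP p) => _; apply.
have [qA|qA] := boolP (q \in A); first by exists q => //; rewrite D_xx.
by exists (m q); [case: (mP q)|apply: pmax; rewrite mem_filter qA].
Qed.

(** Iterates [farthest_point] from the head of [P]. Appending a point keeps the earlier prefixes and
    radii; [r 0] is a dummy, the prefix of length 0 being empty. *)
Lemma farthest_first (x0 : T) (P : seq T) : uniq P ->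
  exists (Q : seq T) (r : nat -> R), [/\ perm_eq Q P,
    forall j, (0 < j < size P)%N ->
      {in P, forall p, exists2 a, a \in take j Q & D p a <= r j} &
    forall j, (0 < j < size P)%N ->
      {in take j Q, forall a, r j <= D (nth x0 Q j) a}].
Proof.
move=> uP.
have build k : (0 < k)%N -> (k <= size P)%N ->
    exists (Q : seq T) (r : nat -> R), [/\ uniq Q, size Q = k, {subset Q <= P},
    forall j, (0 < j < k)%N ->
      {in P, forall p, exists2 a, a \in take j Q & D p a <= r j} &
    forall j, (0 < j < k)%N ->
      {in take j Q, forall a, r j <= D (nth x0 Q j) a}].
  elim: k => // -[_ _|k IH _ kP].
    case: P uP => [|p P] uP szP; first by [].
    exists [:: p], (fun=> 0); split=> // [q|j|j]; last 2 first.
    - by case: j => [|[|j]].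
    - by case: j => [|[|j]].
    by rewrite inE => /eqP ->; exact: mem_head.
  have [//||Q [r [uQ szQ QP cov sep]]] := IH; first exact: ltnW.
  have [||p [t [pP pQ tcov tsep]]] := farthest_point (A := Q) uP.
  - by rewrite -size_eq0 szQ.
  - by rewrite szQ.
  exists (rcons Q p), (fun j => if j == k.+1 then t else r j).
  have tk j : (j <= k.+1)%N -> take j (rcons Q p) = take j Q.
    by move=> jk; rewrite -cats1 takel_cat // szQ.
  split; first by rewrite rcons_uniq pQ.
  - by rewrite size_rcons szQ.
  - by move=> q; rewrite mem_rcons => /predU1P[->|/QP].
  - move=> j /andP[j0]; rewrite ltnS => jk; rewrite tk //.
    case: eqVneq => [->|jk']; first by rewrite -szQ take_size.
    by apply: cov; rewrite j0 ltn_neqAle jk'.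
  - move=> j /andP[j0]; rewrite ltnS => jk; rewrite tk // nth_rcons szQ.
    case: eqVneq => [->|jk']; first by rewrite -szQ ltnn take_size.
    have jk2 : (j < k.+1)%N by rewrite ltn_neqAle jk'.
    by rewrite jk2; apply: sep; rewrite j0.
have [P0|P0] := posnP (size P).
  by exists P, (fun=> 0); split=> // j; rewrite P0 ltn0 andbF.
have [Q [r [uQ szQ QP cov sep]]] := build _ P0 (leqnn _).
exists Q, r; split=> //; apply: uniq_perm => //.
by case: (uniq_min_size uQ QP); rewrite ?szQ.
Qed.
End FarthestFirst.

(** * Unblocked edges of the final graph *)

Section Graph.
Variables (R : realType) (d : nat) (s : R).
Hypothesis s_gt1 : 1 < s.
Implicit Types (E ord : seq (pt R d * pt R d)) (P : seq (pt R d)).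

Let c_gt0 : 0 < 2 * s + 2. Proof. by move: s_gt1 => s1; lra. Qed.

Lemma blocks_self (e : pt R d * pt R d) : blocks s e e.
Proof. by rewrite /blocks !dist_xx !divr_ge0 ?dist_ge0 // ltW. Qed.

(* Edge lists are newest first: [e'] stands for an edge older than [e]. *)
Definition unblocked (e e' : pt R d * pt R d) := ~~ blocks s e' e.

Lemma uncoordinated_unblocked ord : pairwise unblocked (uncoordinated s ord).
Proof.
rewrite /uncoordinated; have : pairwise unblocked [::] by [].
elim: ord [::] => //= e ord IH E EP; apply: IH; rewrite /step.
by case: ifPn => //= eE; rewrite EP andbT all_predC.
Qed.

Lemma uncoordinated_sub ord : {subset uncoordinated s ord <= ord}.
Proof.
move=> e; rewrite /uncoordinated; suff H E : e \in foldl (step s) E ord ->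
    (e \in E) || (e \in ord) by move/H; rewrite in_nil.
elim: ord E => [|e' ord IH] E /=; first by rewrite orbF.
move/IH; rewrite /step in_cons; case: ifP => _; last rewrite in_cons.
  by case/orP => ->; rewrite ?orbT.
by rewrite orbA (orbC (_ == _)).
Qed.

(** An edge blocks itself, so it is never added again, even if [ord] repeats it. *)
Lemma uncoordinated_uniq ord : uniq (uncoordinated s ord).
Proof.
apply: pairwise_uniq (uncoordinated_unblocked ord) => e.
by rewrite /unblocked blocks_self.
Qed.

Lemma mem_uncoordinated P ord e : perm_eq ord (ordered_pairs P) ->
  e \in uncoordinated s ord -> [/\ e.1 \in P, e.2 \in P & e.1 != e.2].
Proof.
move=> op /uncoordinated_sub; rewrite (perm_mem op) mem_filter => /andP[e12].
by case/allpairsP => -[p q] /= [pP qP epq]; rewrite epq in e12 *.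
Qed.

Lemma blocks_common_endpoint (v u u' : pt R d) e e' :
  e \in [:: (u, v); (v, u)] -> e' \in [:: (u', v); (v, u')] ->
  dist u u' <= dist u' v / (2 * s + 2) -> blocks s e' e.
Proof.
rewrite !inE => /orP[]/eqP-> /orP[]/eqP->;
  rewrite /blocks /= ?(dist_sym v u') => ->; by rewrite dist_xx divr_ge0 ?dist_ge0 ?(ltW c_gt0) ?orbT.
Qed.

(** The older of the two edges sets the threshold; the order of insertion is unknown, hence the
    disjunction. *)
Lemma neighbours_far P ord (v u u' : pt R d) :
  perm_eq ord (ordered_pairs P) ->
  let G := uncoordinated s ord in adj G u v -> adj G u' v -> u != u' ->
  dist u v / (2 * s + 2) < dist u u' \/ dist u' v / (2 * s + 2) < dist u u'.
Proof.
move=> op G uv u'v uu'.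
have [e eG eE] : exists2 e, e \in G & e \in [:: (u, v); (v, u)].
  by case/orP: uv => ?; [exists (u, v)|exists (v, u)]; rewrite // !inE eqxx ?orbT.
have [e' e'G e'E] : exists2 e, e \in G & e \in [:: (u', v); (v, u')].
  by case/orP: u'v => ?; [exists (u', v)|exists (v, u')]; rewrite // !inE eqxx ?orbT.
have [_ _ ne] := mem_uncoordinated op eG.
have [_ _ ne'] := mem_uncoordinated op e'G.
have ee' : e != e'.
  apply: contraNneq uu' => ee'; rewrite ee' in eE ne.
  move: eE e'E ne; rewrite !inE => /orP[]/eqP-> /orP[]; rewrite xpair_eqE => /andP[] //=;
  by do 2![move/eqP => ?]; subst; rewrite ?eqxx.
have := pairwise_mem (uncoordinated_unblocked ord) eG e'G ee'.
rewrite /unblocked => -[] nb.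
- right; rewrite ltNge; apply: contra nb; exact: blocks_common_endpoint.
- left; rewrite ltNge dist_sym; apply: contra nb; exact: blocks_common_endpoint.
Qed.

End Graph.

(** * Extreme distances and dyadic logarithms *)

Section Aspect.
Variables (R : realType) (d : nat) (P : seq (pt R d)).
Hypotheses (uP : uniq P) (szP : (2 <= size P)%N).

Lemma le_diam : {in P &, forall u v, dist u v <= diam P}.
Proof.
move=> u v uin vin; apply: (@bigmax_sup_seq _ _ _ _ _ u) => //.
exact: (@bigmax_sup_seq _ _ _ _ _ v).
Qed.

Lemma mindist_le : {in P &, forall u v, u != v -> mindist P <= dist u v}.
Proof.
move=> u v uin vin uv; apply: (@bigmin_inf_seq _ _ _ _ _ u) => //.
exact: (@bigmin_inf_seq _ _ _ _ _ v).
Qed.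

(** The minimum starts from the default value [diam P], so [diam P] must be shown positive too. *)
Lemma mindist_gt0 : 0 < mindist P.
Proof.
have diam0 : 0 < diam P.
  have := le_diam; case: P uP szP => [|u [|v S]] //= /andP[+ _] _.
  rewrite inE negb_or => /andP[uv _] /(_ u v) h.
  by apply: lt_le_trans (dist_gt0 uv) (h _ _); rewrite !inE eqxx ?orbT.
by apply: lt_bigmin => // u _; apply: lt_bigmin => // v uv; exact: dist_gt0.
Qed.
End Aspect.

Section Lg.
Variable R : realType.
Implicit Types x y : R.

Lemma ln2_gt0 : 0 < ln 2 :> R. Proof. by apply: ln_gt0; lra. Qed.

Lemma le_lg x y : 0 < x -> x <= y -> lg x <= lg y.
Proof.
move=> x0 xy; rewrite /lg ler_pM2r ?invr_gt0 ?ln2_gt0 // ler_ln // posrE //.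
exact: lt_le_trans xy.
Qed.

Lemma lg_ge0 x : 1 <= x -> 0 <= lg x.
Proof. by move=> x1; rewrite divr_ge0 ?ln_ge0 ?ler1n. Qed.

Lemma trunc_lg_bounds x : 1 <= x ->
  2 ^+ Num.trunc (lg x) <= x < 2 ^+ (Num.trunc (lg x)).+1.
Proof.
move=> x1; have x0 : 0 < x by lra.
have p2 n : 2 ^+ n \is @Num.pos R by rewrite posrE exprn_gt0.
have := truncn_itv (lg_ge0 x1); rewrite /lg ler_pdivlMr ?ln2_gt0 //.
rewrite ltr_pdivrMr ?ln2_gt0 // => /andP[h1 h2].
have xp : x \is Num.pos by rewrite posrE.
rewrite -(ler_ln (p2 _) xp) -(ltr_ln xp (p2 _)) !lnXn //.
by rewrite -2!(mulr_natl (ln 2)) h1.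
Qed.
End Lg.

(** * Degree sum and maximum degree *)

(** Handshake count. Only an inequality, because [E] is arbitrary and [adj] counts once a pair
    stored in both orientations. *)
Lemma sum_degree_le (R : realType) (d : nat) (P : seq (pt R d)) E : uniq P ->
  (\sum_(v <- P) degree P E v <= 2 * size E)%N.
Proof.
move=> uP.
have countE (T : Type) (S : seq T) (a : pred T) :
    count a S = (\sum_(x <- S) a x)%N by rewrite -sumn_count sumnE big_map.
have sum_le : (\sum_(u <- P) \sum_(v <- P) ((u, v) \in E) <= size E)%N.
  rewrite -(big_allpairs (F := fun e => nat_of_bool (e \in E))) -countE.
  rewrite -size_filter; apply: uniq_leq_size => [|e].
    by rewrite filter_uniq // allpairs_uniq // => -[? ?] [? ?].
  by rewrite mem_filter => /andP[].
rewrite mul2n -addnn; apply: leq_trans (leq_add sum_le sum_le).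
rewrite {1}exchange_big -big_split /=; apply: leq_sum => v _.
rewrite /degree countE -big_split /=; apply: leq_sum => u _.
by rewrite /adj; do 2!case: (_ \in E).
Qed.

Lemma lg_aspect_ratio_ge0 (R : realType) (d : nat) (P : seq (pt R d)) :
  uniq P -> (2 <= size P)%N -> 0 <= lg (aspect_ratio P).
Proof.
move=> uP szP; have del0 := mindist_gt0 uP szP.
rewrite /aspect_ratio lg_ge0 // ler_pdivlMr // mul1r.
have [x [y [xP yP xy]]] : exists x y, [/\ x \in P, y \in P & x != y].
  case: (P) uP szP => [|x [|y Q]] //=; rewrite inE negb_or -!andbA => /andP[xy _] _.
  by exists x, y; rewrite !inE !eqxx orbT.
exact: le_trans (mindist_le xP yP xy) (le_diam xP yP).
Qed.

Lemma degree_le (R : realType) (d : nat) (s : R) (P : seq (pt R d)) ord v :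
  1 < s -> uniq P -> (2 <= size P)%N -> perm_eq ord (ordered_pairs P) -> v \in P ->
  (degree P (uncoordinated s ord) v)%:R <=
    (1 + lg (aspect_ratio P)) * (2 * (2 * (2 * s + 2)) * d.+1%:R + 1) ^+ d.
Proof.
move=> s1 uP szP op vP; set G := uncoordinated s ord.
have c0 : 0 < 2 * s + 2 by lra.
have del0 := mindist_gt0 uP szP; set del := mindist P in del0.
pose S := [seq u <- P | adj G u v].
have SP u : u \in S -> u \in P by rewrite mem_filter => /andP[].
have Sv u : u \in S -> u != v.
  rewrite mem_filter => /andP[/orP[]] /(mem_uncoordinated op)[_ _] //=.
  by rewrite eq_sym.
have lg_ge u : u \in S -> 1 <= dist u v / del.
  by move=> uS; rewrite ler_pdivlMr // mul1r; exact: mindist_le (SP _ uS) vP (Sv _ uS).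
have le_ar u : u \in S -> dist u v / del <= aspect_ratio P.
  by move=> uS; rewrite ler_pM2r ?invr_gt0 // (le_diam (SP _ uS) vP).
have lgar0 := lg_aspect_ratio_ge0 uP szP.
set B := (X in _ * X).
have B0 : 0 <= B by rewrite exprn_ge0 // addr_ge0 // !mulr_ge0 // ltW.
apply: (@le_trans _ _ ((Num.trunc (lg (aspect_ratio P))).+1%:R * B)); last first.
  by apply: ler_wpM2r => //; rewrite -natr1 addrC lerD2l truncn_le.
rewrite /degree -size_filter -/S.
apply: (size_le_fibers (f := fun u => Num.trunc (lg (dist u v / del)))).
  apply/allP => u uS; rewrite ltnS; apply: le_truncn; apply: le_lg; last exact: le_ar.
  by apply: lt_le_trans (lg_ge _ uS).
move=> k _; rewrite -size_filter; set F := filter _ _.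
have FP u : u \in F -> 2 ^+ k * del <= dist u v < 2 ^+ k.+1 * del.
  rewrite mem_filter => /andP[/eqP fk uS].
  have := trunc_lg_bounds (lg_ge _ uS).
  by rewrite fk ler_pdivlMr // ltr_pdivrMr.
have t0 : 0 < 2 ^+ k * del by rewrite mulr_gt0 // exprn_gt0.
(* The separation is the lower end of the class over [2 * s + 2]; the upper end is
   [K = 2 * (2 * s + 2)] times that. *)
apply: (@packing _ _ v (2 ^+ k * del / (2 * s + 2))).
- by rewrite divr_gt0.
- by rewrite mulr_ge0 // ltW.
- by rewrite !filter_uniq.
- move=> u /FP/andP[_ /ltW]; rewrite exprS => /le_trans; apply.
  by rewrite le_eqVlt; apply/orP; left; apply/eqP; field; lra.
- move=> u u' uF u'F uu'.
  have adjF w : w \in F -> adj G w v.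
    by rewrite mem_filter => /andP[_]; rewrite mem_filter => /andP[].
  have [] := neighbours_far s1 op (adjF _ uF) (adjF _ u'F) uu' => /ltW; apply: le_trans.
    by rewrite ler_pM2r ?invr_gt0 //; case/andP: (FP _ uF).
  by rewrite ler_pM2r ?invr_gt0 //; case/andP: (FP _ u'F).
Qed.

(** * Moving edges onto the net, and the edge count *)

Section NetPair.
Variables (R : realType) (d : nat) (x0 : pt R d) (P Q : seq (pt R d)) (r : nat -> R).
Hypothesis QP : perm_eq Q P.
Hypothesis cov : forall j, (0 < j < size P)%N ->
  {in P, forall p, exists2 a, a \in take j Q & dist p a <= r j}.

(** [a] and [b] lie in the shortest nonempty prefix covering [P] within [t]. They differ since
    [2 * t < dist p q], and the later one has index [j], with [t < r j] by minimality of the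
    prefix. *)
Lemma net_pair p q t : p \in P -> q \in P -> 0 < t -> 2 * t < dist p q ->
  exists j a b, [/\ dist p a <= t, dist q b <= t, (0 < j < size P)%N, t < r j &
    (a = nth x0 Q j /\ b \in take j Q) \/ (b = nth x0 Q j /\ a \in take j Q)].
Proof.
move=> pP qP t0 pqt.
(* Nothing is known of [r] from [size P] on, but there the prefix is all of [P] and covers
   trivially. *)
pose stop k := (0 < k)%N && ((size P <= k)%N || (r k <= t)).
have ex_stop : exists k, stop k.
  by exists (size P); rewrite /stop leqnn andbT; case: (P) pP.
case: (ex_minnP ex_stop) => k /andP[k0 kstop] kmin.
have covk : {in P, forall p, exists2 a, a \in take k Q & dist p a <= t}.
  move=> x xP; have [kP|kP] := leqP (size P) k.
    exists x; last by rewrite dist_xx ltW.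
    by rewrite take_oversize ?(perm_size QP) // (perm_mem QP).
  move: kstop; rewrite leqNgt kP /= => rk.
  have [|a aQ xa] := cov (j := k) _ xP; first by rewrite k0.
  by exists a => //; exact: le_trans rk.
have [a ak pa] := covk p pP; have [b bk qb] := covk q qP.
have ab : a != b.
  apply/negP => /eqP ab; have := dist_triangle a p q.
  by rewrite {2}ab (dist_sym b); lra.
have aQ := mem_take ak; have bQ := mem_take bk.
move: ak bk; rewrite !in_take // => ak bk.
have big j : (0 < j < k)%N -> t < r j.
  move=> /andP[j0 jk]; rewrite ltNge; apply/negP => rj.
  by have := kmin j; rewrite /stop j0 rj orbT leqNgt jk => /(_ isT).
have [iab|iba|eqi] := ltngtP (index a Q) (index b Q).
- exists (index b Q), a, b; split=> //.
  + by rewrite (leq_trans _ iab) // -(perm_size QP) index_mem.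
  + by rewrite big // bk (leq_trans _ iab).
  + by right; rewrite nth_index // in_take.
- exists (index a Q), a, b; split=> //.
  + by rewrite (leq_trans _ iba) // -(perm_size QP) index_mem.
  + by rewrite big // ak (leq_trans _ iba).
  + by left; rewrite nth_index // in_take.
- by move: ab; rewrite -(nth_index x0 aQ) eqi nth_index // eqxx.
Qed.

Hypothesis sep : forall j, (0 < j < size P)%N ->
  {in take j Q, forall a, r j <= dist (nth x0 Q j) a}.
Hypothesis uP : uniq P.

(** If [b] is the later point, at index [i < j], [sep] gives [r i <= dist a b]. Moreover
    [r j <= r i]: by [cov], the point of index [j] is within [r i] of some earlier [z], from which
    [sep] keeps it [r j] away. *)
Lemma prefix_separated j : (0 < j < size P)%N ->
  {in take j Q &, forall a b, a != b -> r j <= dist a b}.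
Proof.
move=> jP; have /andP[j0 jltP] := jP.
have uQ : uniq Q by rewrite (perm_uniq QP).
have main a b : a \in Q -> b \in Q -> (index a Q < index b Q < j)%N -> r j <= dist a b.
  move=> aQ bQ /andP[iab ibj].
  have iP : (0 < index b Q < size P)%N.
    by rewrite (leq_trans _ iab) //= (ltn_trans ibj).
  have xP : nth x0 Q j \in P by rewrite -(perm_mem QP) mem_nth // (perm_size QP).
  have [z zb xz] := cov iP xP.
  have zQ := mem_take zb.
  have zj : z \in take j Q.
    by move: zb; rewrite !in_take // => /ltn_trans; apply.
  apply: le_trans (sep jP zj) _; apply: le_trans xz _.
  by rewrite dist_sym -{2}(nth_index x0 bQ) sep // in_take.
move=> a b aj bj ab; have aQ := mem_take aj; have bQ := mem_take bj.
move: aj bj; rewrite !in_take // => aj bj.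
have [iab|iba|eqi] := ltngtP (index a Q) (index b Q).
- by apply: main => //; rewrite iab.
- by rewrite dist_sym; apply: main => //; rewrite iba.
- by move: ab; rewrite -(nth_index x0 aQ) eqi nth_index // eqxx.
Qed.
End NetPair.

(** Edges with the same ordered image have comparable lengths and nearby endpoints, so each would
    block the other, whichever came first. *)
Lemma net_pair_inj (R : realType) (d : nat) (s : R) ord (a b : pt R d) :
  1 < s -> let G := uncoordinated s ord in
  {in G &, forall e e' : pt R d * pt R d,
    dist e.1 a <= dist e.1 e.2 / (4 * (2 * s + 2)) ->
    dist e.2 b <= dist e.1 e.2 / (4 * (2 * s + 2)) ->
    dist e'.1 a <= dist e'.1 e'.2 / (4 * (2 * s + 2)) ->
    dist e'.2 b <= dist e'.1 e'.2 / (4 * (2 * s + 2)) -> e = e'}.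
Proof.
move=> s1 G e e' eG e'G.
have c0 : 0 < 2 * s + 2 by lra.
have block (f f' : pt R d * pt R d) :
    dist f.1 a <= dist f.1 f.2 / (4 * (2 * s + 2)) ->
    dist f.2 b <= dist f.1 f.2 / (4 * (2 * s + 2)) ->
    dist f'.1 a <= dist f'.1 f'.2 / (4 * (2 * s + 2)) ->
    dist f'.2 b <= dist f'.1 f'.2 / (4 * (2 * s + 2)) -> blocks s f' f.
  move=> h1 h2 h3 h4.
  have small (g : pt R d * pt R d) :
      (* Here [1 < s] gives [4 * (2 * s + 2) > 16]. *)
      dist g.1 g.2 / (4 * (2 * s + 2)) <= dist g.1 g.2 / 16.
    have := dist_ge0 g.1 g.2; set l := dist _ _ => l0.
    by apply: ler_wpM2l => //; rewrite lef_pV2 ?posrE; lra.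
  have e1 : dist f'.1 f'.2 / (2 * s + 2) = 4 * (dist f'.1 f'.2 / (4 * (2 * s + 2))).
    by field; lra.
  have lf := small f; have lf' := small f'.
  have t1 := dist_triangle a f.1 f'.1; have t2 := dist_triangle b f.2 f'.2.
  have t3 := dist_triangle a f.1 f.2; have t4 := dist_triangle b a f.2.
  have t5 := dist_triangle f'.1 a b; have t6 := dist_triangle f'.2 f'.1 b.
  rewrite (dist_sym a f'.1) in t1 t5; rewrite (dist_sym b f'.2) in t2.
  rewrite (dist_sym b f.2) in t4.
  (* The factor 3 suffices: matching endpoints are then within [3 + 1 = 4] displacements of [f'],
     which is the blocking radius [e1]. *)
  have l0 := dist_ge0 f'.1 f'.2; have ll : dist f.1 f.2 <= 3 * dist f'.1 f'.2 by lra.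
  have : dist f.1 f.2 / (4 * (2 * s + 2)) <= 3 * (dist f'.1 f'.2 / (4 * (2 * s + 2))).
    by rewrite mulrA ler_pM2r // invr_gt0; lra.
  move=> h; rewrite /blocks e1; apply/orP; left; apply/andP; split; lra.
move=> h1 h2 h3 h4; apply/eqP/negPn/negP => ee'.
have := pairwise_mem (uncoordinated_unblocked s ord) eG e'G ee'.
by rewrite /unblocked => -[]; rewrite block.
Qed.

Lemma size_uncoordinated_le (R : realType) (d : nat) (s : R) (P : seq (pt R d)) ord :
  1 < s -> uniq P -> perm_eq ord (ordered_pairs P) ->
  (size (uncoordinated s ord))%:R <=
    (size P)%:R * (2 * (2 * (4 * (2 * s + 2) + 2) * d.+1%:R + 1) ^+ d).
Proof.
move=> s1 uP op; set G := uncoordinated s ord; set c := 4 * (2 * s + 2).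
(* This [c] is four times the blocking constant [2 * s + 2]. *)
have c0 : 0 < c by rewrite /c; lra.
have [Q [r [QP cov sep]]] := farthest_first (@dist_ge0 R d) (@dist_xx R d) 0 uP.
pose x j := nth 0 Q j.
have ch (e : pt R d * pt R d) : exists z : nat * (pt R d * pt R d), e \in G ->
    let: (j, (a, b)) := z in
    [/\ dist e.1 a <= dist e.1 e.2 / c, dist e.2 b <= dist e.1 e.2 / c,
     (0 < j < size P)%N, dist e.1 e.2 / c < r j &
    (a = x j /\ b \in take j Q) \/ (b = x j /\ a \in take j Q)].
  have [eG|_] := boolP (e \in G); last by exists (0%N, (0, 0)).
  have [e1 e2 /dist_gt0 ne] := mem_uncoordinated op eG.
  have [||j [a [b h]]] := net_pair 0 QP cov (t := dist e.1 e.2 / c) e1 e2.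
  - by rewrite divr_gt0.
  - by rewrite mulrA ltr_pdivrMr // /c; nra.
  by exists (j, (a, b)).
have [g gP] := choice ch.
apply: (size_le_fibers (f := fun e => (g e).1)).
  by apply/allP => e /gP; case: (g e) => j [a b] [_ _ /andP[_]].
move=> j _; rewrite -size_filter; set F := filter _ _.
have FG e : e \in F -> e \in G by rewrite mem_filter => /andP[].
have FP e : e \in F -> 
    [/\ dist e.1 (g e).2.1 <= dist e.1 e.2 / c, dist e.2 (g e).2.2 <= dist e.1 e.2 / c,
     (0 < j < size P)%N, dist e.1 e.2 / c < r j &
    ((g e).2.1 = x j /\ (g e).2.2 \in take j Q) \/
    ((g e).2.2 = x j /\ (g e).2.1 \in take j Q)].
  rewrite mem_filter => /andP[/eqP <- /gP]; by case: (g e) => i [a b].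
(* An edge of the fiber is what provides [0 < r j], needed for packing, so an empty fiber is treated
   apart. *)
have [F0|[e0 e0F]] : F = [::] \/ exists e, e \in F.
  by case: (F) => [|e S]; [left|right; exists e; rewrite mem_head].
  rewrite F0 mulr_ge0 // exprn_ge0 // addr_ge0 // !mulr_ge0 //; lra.
have [_ _ jP jr _] := FP _ e0F.
have rj0 : 0 < r j by apply: le_lt_trans jr; rewrite divr_ge0 ?dist_ge0 // ltW.
pose T := [seq a <- take j Q | dist a (x j) <= (c + 2) * r j].
have uT : uniq T by rewrite filter_uniq // take_uniq // (perm_uniq QP).
have szT : (size T)%:R <= (2 * (c + 2) * d.+1%:R + 1) ^+ d :> R.
  apply: (@packing _ _ (x j) (r j)) => //; first lra.
    by move=> a; rewrite mem_filter => /andP[].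
  move=> a b; rewrite !mem_filter => /andP[_ aT] /andP[_ bT].
  exact: (prefix_separated QP cov sep uP).
(* Images are ordered pairs, so each [a] in [T] accounts for two: [(a, x j)] and [(x j, a)]. *)
suff : (size F <= 2 * size T)%N.
  rewrite -(ler_nat R) natrM => /le_trans; apply; exact: ler_wpM2l.
rewrite mul2n -addnn -{1}(size_map (fun a => (a, x j)) T).
rewrite -(size_map (fun a => (x j, a)) T) -size_cat.
rewrite -(size_map (fun e => (g e).2) F); apply: uniq_leq_size.
  rewrite map_inj_in_uniq ?filter_uniq ?uncoordinated_uniq // => e e' eF e'F gee'.
  have [h1 h2 _ _ _] := FP _ eF; have [h3 h4 _ _ _] := FP _ e'F.
  by apply: (net_pair_inj s1 (FG _ eF) (FG _ e'F) h1 h2); rewrite gee'.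
move=> _ /mapP[e eF ->]; have [h1 h2 _ h3 h4] := FP _ eF.
(* The edge has length at most [c * r j], and each endpoint moves by at most [r j]. *)
have near : dist (g e).2.1 (g e).2.2 <= (c + 2) * r j.
  have t1 := dist_triangle e.1 (g e).2.1 (g e).2.2.
  have t2 := dist_triangle e.2 e.1 (g e).2.2.
  rewrite dist_sym in h1.
  have ll : dist e.1 e.2 <= c * r j by rewrite mulrC -ler_pdivrMr // ltW.
  by lra.
case: (g e).2 h4 near {h1 h2} => a b /= h4 near; rewrite mem_cat; apply/orP.
case: h4 near => -[-> zj] near; [right|left]; apply: map_f; rewrite mem_filter zj andbT //.
by rewrite dist_sym.
Qed.

(** * Choice of the constant *)

(** [C] is chosen before [R], [s] and [P], so it depends on [d] only. The summand [1 +] covers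
    aspect ratio 1: for two points [lg] gives 0, yet both degrees are 1. *)
Theorem theorem10 (d : nat) (hd : (1 <= d)%N) :
  exists C : nat,
    forall (R : realType) (s : R) (P : seq (pt R d)) (ord : seq (pt R d * pt R d)),
      1 < s -> uniq P -> (2 <= size P)%N ->
      perm_eq ord (ordered_pairs P) ->
      let G := uncoordinated s ord in
      (forall v, v \in P ->
         (degree P G v)%:R <= C%:R * (1 + lg (aspect_ratio P)) * s ^+ d) /\
      avg_degree P G <= C%:R * s ^+ d.
Proof.
(* The packing ratios [K] are [4 * s + 4] and [8 * s + 10], both at most [18 * s] as [1 < s]; this
   gives [36 = 2 * 18]. The 4 is 2 from the handshake times 2 from ordered images. *)
exists (4 * (36 * d.+1 + 1) ^ d)%N => R s P ord s1 uP szP op G.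
have D0 : 0 <= d.+1%:R :> R by [].
have bound K : 0 <= K <= 18 * s ->
    (2 * K * d.+1%:R + 1) ^+ d <= ((36 * d.+1 + 1) ^ d)%:R * s ^+ d.
  move=> /andP[K0 K1]; rewrite natrX -exprMn natrD natrM.
  apply: lerXn2r; rewrite ?nnegrE ?addr_ge0 ?mulr_ge0 //; nra.
have N0 : 0 <= ((36 * d.+1 + 1) ^ d)%:R * s ^+ d by rewrite mulr_ge0 // exprn_ge0 //; lra.
split=> [v vP|].
  have deg := degree_le s1 uP szP op vP.
  have L0 : 0 <= 1 + lg (aspect_ratio P).
    by rewrite addr_ge0 ?lg_aspect_ratio_ge0.
  apply: le_trans deg _; rewrite natrM [leRHS]mulrAC [leLHS]mulrC.
  by apply: ler_wpM2r => //; rewrite -[leRHS]mulrA; apply: le_trans (bound _ _) _; lra.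
rewrite /avg_degree ler_pdivrMr ?ltr0n ?(ltn_trans _ szP) //.
rewrite -natr_sum; apply: (@le_trans _ _ (2 * size G)%:R).
  by rewrite ler_nat sum_degree_le.
rewrite natrM; have := size_uncoordinated_le s1 uP op; rewrite -/G => szG.
have bd : (2 * (4 * (2 * s + 2) + 2) * d.+1%:R + 1) ^+ d <=
  ((36 * d.+1 + 1) ^ d)%:R * s ^+ d by apply: bound; lra.
apply: (@le_trans _ _ (2 * ((size P)%:R * (2 * (((36 * d.+1 + 1) ^ d)%:R * s ^+ d))))).
  rewrite ler_pM2l //; apply: le_trans szG _.
  by rewrite !ler_wpM2l.
by rewrite natrM le_eqVlt; apply/orP; left; apply/eqP; ring.
Qed.
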